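(* Suppose that every $\mathbb{C}$-algebra endomorphism $f$ of $\mathbb{C}[x,y]$ with $\operatorname{Jac}(f(x),f(y))\in\mathbb{C}^*$ is an automorphism of $\mathbb{C}[x,y]$ (the two-dimensional Jacobian Conjecture over $\mathbb{C}$). Then for every integral domain $D$ of characteristic zero and all $A,B,w\in D[x,y]$ with $\operatorname{Jac}(A,B)\in D^*$ and $\operatorname{Jac}(A,w)=0$, one has $w\in D[A]$.
   Context: $\operatorname{Jac}(u,v):=u_xv_y-u_yv_x$ for polynomials $u,v$ in two variables $x,y$. $D^*$ is the group of units of $D$. $D[A]$ is the $D$-subalgebra of $D[x,y]$ generated by $A$. *)

(* Defs.v *)
From Stdlib Require Import Reals Lra Psatz ClassicalEpsilon FunctionalExtensionality.
From HB Require Import structures.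
From mathcomp Require Import all_boot all_order all_algebra.

Set Implicit Arguments.
Unset Strict Implicit.
Unset Printing Implicit Defensive.

Inductive complex : Type := Cplx of Rdefinitions.R & Rdefinitions.R.

Definition Re_c (z : complex) := let: Cplx a _ := z in a.
Definition Im_c (z : complex) := let: Cplx _ b := z in b.

Local Open Scope R_scope.

Definition complex_eqb (z w : complex) : bool :=
  let: Cplx a b := z in let: Cplx c d := w in
  (if Req_EM_T a c then true else false) && (if Req_EM_T b d then true else false).

Lemma complex_eqP : Equality.axiom complex_eqb.
Proof.
move=> [a b] [c d] /=.
case: (Req_EM_T a c) => h; case: (Req_EM_T b d) => h' /=;
  constructor; try (by rewrite h h'); case=> *; by [apply: h | apply: h'].
Qed.

HB.instance Definition _ := hasDecEq.Build complex complex_eqP.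

Definition complex_find (P : pred complex) (n : nat) : option complex :=
  match excluded_middle_informative (exists x, P x) with
  | left H => Some (proj1_sig (constructive_indefinite_description _ H))
  | right _ => None
  end.

Lemma complex_find_correct P n x : complex_find P n = Some x -> P x.
Proof.
rewrite /complex_find; case: excluded_middle_informative => // H [<-].
exact: proj2_sig (constructive_indefinite_description _ H).
Qed.

Lemma complex_find_complete (P : pred complex) :
  (exists x, P x) -> exists n, complex_find P n.
Proof.
move=> H; exists 0%N; rewrite /complex_find.
by case: excluded_middle_informative.
Qed.

Lemma complex_find_ext (P Q : pred complex) :
  P =1 Q -> complex_find P =1 complex_find Q.
Proof.
move=> PQ n; have -> : P = Q by apply: functional_extensionality.
by [].
Qed.

HB.instance Definition _ := hasChoice.Build complex
  complex_find_correct complex_find_complete complex_find_ext.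

Definition c0 := Cplx 0 0.
Definition c1 := Cplx 1 0.
Definition cadd (z w : complex) :=
  let: Cplx a b := z in let: Cplx c d := w in Cplx (a + c) (b + d).
Definition copp (z : complex) := let: Cplx a b := z in Cplx (- a) (- b).
Definition cmul (z w : complex) :=
  let: Cplx a b := z in let: Cplx c d := w in
  Cplx (a * c - b * d) (a * d + b * c).
Definition cinv (z : complex) :=
  let: Cplx a b := z in
  Cplx (a / (a * a + b * b)) (- b / (a * a + b * b)).

Lemma caddA : associative cadd.
Proof. move=> [a b] [c d] [e f] /=; congr Cplx; ring. Qed.
Lemma caddC : commutative cadd.
Proof. move=> [a b] [c d] /=; congr Cplx; ring. Qed.
Lemma cadd0 : left_id c0 cadd.
Proof. move=> [a b] /=; congr Cplx; ring. Qed.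
Lemma caddN : left_inverse c0 copp cadd.
Proof. move=> [a b] /=; rewrite /c0; congr Cplx; ring. Qed.

HB.instance Definition _ := GRing.isZmodule.Build complex caddA caddC cadd0 caddN.

Lemma cmulA : associative cmul.
Proof. move=> [a b] [c d] [e f] /=; congr Cplx; ring. Qed.
Lemma cmulC : commutative cmul.
Proof. move=> [a b] [c d] /=; congr Cplx; ring. Qed.
Lemma cmul1 : left_id c1 cmul.
Proof. move=> [a b] /=; congr Cplx; ring. Qed.
Lemma cmulDl : left_distributive cmul cadd.
Proof. move=> [a b] [c d] [e f] /=; congr Cplx; ring. Qed.
Lemma c1_neq0 : c1 != c0.
Proof. apply/eqP; case=> h; lra. Qed.

HB.instance Definition _ :=
  GRing.Zmodule_isComNzRing.Build complex cmulA cmulC cmul1 cmulDl c1_neq0.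

Lemma cmulV (z : complex) : z != 0%R -> cmul (cinv z) z = c1.
Proof.
case: z => a b /eqP nz /=.
have hab : a * a + b * b <> 0.
  move=> h; apply: nz; have ha : a = 0 by nra.
  have hb : b = 0 by nra.
  by rewrite ha hb.
rewrite /c1; congr Cplx; field; exact: hab.
Qed.

Lemma cinv0 : cinv 0%R = 0%R.
Proof. rewrite /= /c0 /cinv; congr Cplx; rewrite /Rdiv; ring. Qed.

HB.instance Definition _ := GRing.ComNzRing_isField.Build complex cmulV cinv0.

Local Close Scope R_scope.

(* Bivariate polynomials D[x,y] are represented as {poly {poly D}} = (D[y])[x]:
   the outer variable is x, the inner variable is y.                         *)

Import GRing.Theory.
Local Open Scope ring_scope.

Notation "{ 'bipoly' D }" := {poly {poly D}} (format "{ 'bipoly'  D }").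

Definition bx {D : nzRingType} : {poly {poly D}} := 'X.
Definition by_ {D : nzRingType} : {poly {poly D}} := ('X)%:P.

Definition bC {D : nzRingType} (c : D) : {poly {poly D}} := c%:P%:P.

Definition dx {D : nzRingType} (p : {poly {poly D}}) : {poly {poly D}} := p^`().
Definition dy {D : nzRingType} (p : {poly {poly D}}) : {poly {poly D}} :=
  map_poly (@deriv D) p.

Definition Jac {D : comNzRingType} (u v : {poly {poly D}}) : {poly {poly D}} :=
  dx u * dy v - dy u * dx v.

Definition in_units_const {D : comUnitRingType} (p : {poly {poly D}}) : Prop :=
  exists2 c : D, c \is a GRing.unit & p = bC c.

Definition in_subalg_gen {D : comNzRingType} (A w : {poly {poly D}}) : Prop :=
  exists g : {poly D}, w = (map_poly bC g).[A].

Definition is_alg_endo {D : comNzRingType}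
    (f : {rmorphism {poly {poly D}} -> {poly {poly D}}}) : Prop :=
  forall c : D, f (bC c) = bC c.

Definition JacobianConjecture2_C : Prop :=
  forall f : {rmorphism {poly {poly complex}} -> {poly {poly complex}}},
    is_alg_endo f ->
    in_units_const (Jac (f bx) (f by_)) ->
    bijective f.

(* Main.v *)
From HB Require Import structures.
From Stdlib Require Import Classical.
From mathcomp Require Import all_boot all_order all_algebra.
From mathcomp Require Import Rstruct.
From mathcomp Require complex.
Require Import Defs.
Import GRing.Theory.
Set Implicit Arguments.
Unset Strict Implicit.
Unset Printing Implicit Defensive.
Local Open Scope ring_scope.

(* Over the complex numbers the conjecture makes [f : x, y |-> A, B] bijective;
   writing [w = f P], the chain rule gives [Jac A w = f (P_y) * Jac A B], hence
   [P_y = 0] and [w] is a polynomial in [A].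

   For a general domain [D], the unit linear part of the Jacobian pair yields a
   line [(x, y) = (al t, be t)] on which [A] restricts to [a_0 + t + ...].
   Comparing expansions on this line produces a polynomial [g] over [D] such
   that [w = g(A)] holds up to order [m] along the line, [m] exceeding the
   degree of [w] there. If [w - g(A)] had a nonzero coefficient, a ring morphism
   from the finitely generated subring of [D] containing all the data to the
   complex numbers could be chosen not to kill it (a weak Nullstellensatz).
   Over the complex numbers [w = h(A)] with [deg h < m], and the expansion on
   the line forces [h] to be the image of [g], a contradiction. *)

(** * Specialization of finitely generated domains *)

Definition eval_at (R S : comNzRingType) (f : {rmorphism R -> S}) (a : S) :
  {rmorphism {poly R} -> S} := horner_morph (fun x => mulrC a (f x)).

Lemma eval_atE (R S : comNzRingType) (f : {rmorphism R -> S}) (a : S) P :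
  eval_at f a P = (map_poly f P).[a].
Proof. by []. Qed.

Lemma eval_atC (R S : comNzRingType) (f : {rmorphism R -> S}) (a : S) c :
  eval_at f a c%:P = f c.
Proof. by rewrite eval_atE map_polyC hornerC. Qed.

Lemma eval_atX (R S : comNzRingType) (f : {rmorphism R -> S}) (a : S) :
  eval_at f a 'X = a.
Proof. by rewrite eval_atE map_polyX hornerX. Qed.

Lemma eval_atZ (R S : comNzRingType) (f : {rmorphism R -> S}) (a : S) c P :
  eval_at f a (c *: P) = f c * eval_at f a P.
Proof. by rewrite -mul_polyC rmorphM eval_atC. Qed.

(* The pair [(T, e)] stands for the subring [e T] of [D]: a morphism on [T]
   vanishing on the kernel of [e] is a morphism on that subring. *)
Definition specializable (T D : comNzRingType) (K : fieldType)
    (e : {rmorphism T -> D}) : Prop :=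
  forall d : T, e d != 0 ->
  exists2 phi : {rmorphism T -> K},
    (forall t, e t = 0 -> phi t = 0) & phi d != 0.

Lemma ex_minimal_size (T : nzRingType) (P : {poly T} -> Prop) :
  (exists p, P p) -> exists2 p, P p & forall q, P q -> (size p <= size q)%N.
Proof.
case=> p; have [n] := ubnP (size p).
elim: n p => // n IHn p; rewrite ltnS => le_p_n Pp.
have [[q Pq lt_qp] | no_smaller] :=
  classic (exists2 q, P q & (size q < size p)%N).
  exact: IHn (leq_trans lt_qp le_p_n) Pq.
exists p => // q Pq; rewrite leqNgt; apply/negP => lt_qp.
by apply: no_smaller; exists q.
Qed.

Section Adjunction.
Variables (T D : idomainType) (e : {rmorphism T -> D}) (a : D).

(** An ideal of [{poly T}]: divisibility by [d] is taken in [(e T)[a]], not in [D]. For [d = 0] it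
    is the vanishing ideal of [a], so the next lemma serves both cases. *)
Definition value_mult (d : D) (N : {poly T}) : Prop :=
  exists s : {poly T}, eval_at e a N = eval_at e a s * d.

(** Removing a leading term whose coefficient is killed by [e] leaves the value at [a] unchanged, so
    the terms can be stripped one by one. *)
Lemma map_poly_eq0_lt_size d m :
  (forall N, value_mult d N -> (size N < m)%N -> e (lead_coef N) = 0) ->
  forall N, value_mult d N -> (size N < m)%N -> map_poly e N = 0.
Proof.
move=> lead0 N; have [n] := ubnP (size N).
elim: n N => // n IHn N; rewrite ltnS => le_N_n JN ltNm.
have [->|nzN] := eqVneq N 0; first by rewrite map_poly0.
set N' := take_poly (size N).-1 N.
have eN' : map_poly e N' = map_poly e N.
  apply/polyP=> i; rewrite !coef_map /= coef_take_poly.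
  case: ltngtP => //.
    rewrite -ltnS prednK ?size_poly_gt0 // => /leq_sizeP-> //.
  by move=> ->; rewrite -lead_coefE lead0 // rmorph0.
have ltN' : (size N' < size N)%N.
  by rewrite -(prednK (n:=size N)) ?size_poly_gt0 // ltnS size_take_poly.
rewrite -eN'; apply: IHn.
- exact: leq_trans ltN' le_N_n.
- by case: JN => s Js; exists s; rewrite eval_atE eN'.
- exact: ltn_trans ltN' ltNm.
Qed.

(** Division over a domain is pseudo-division: [p] is first multiplied by a power of [lead_coef N],
    which stays inside the ideal. *)
Lemma value_mult_modp d p N : value_mult d p -> value_mult d N ->
  value_mult d (p %% N).
Proof.
move=> [s Es] [t Et]; exists (lead_coef N ^+ scalp p N *: s - (p %/ N) * t).
have := congr1 (eval_at e a) (Pdiv.Idomain.divp_eq p N).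
rewrite eval_atZ rmorphD rmorphB !rmorphM eval_atZ mulrBl -!mulrA -Et -Es => ->.
by rewrite addrC addKr.
Qed.

(* The constant [r] plays the role of the resultant of the minimal polynomial
   [p] of [a] and [delta]; it is found as an element of least degree, so that
   no passage to the fraction field of [e T] is needed. *)
Lemma eval_dvd_const (p delta : {poly T}) :
    eval_at e a p = 0 -> e (lead_coef p) != 0 ->
    (forall q, eval_at e a q = 0 -> (size q < size p)%N -> map_poly e q = 0) ->
    eval_at e a delta != 0 ->
  exists2 r : T, e r != 0 & value_mult (eval_at e a delta) r%:P.
Proof.
move=> p0 lp minp nzd; set d := eval_at e a delta.
have Jp : value_mult d p by exists 0; rewrite p0 rmorph0 mul0r.
have [|N [JN lN] minN] := @ex_minimal_size _
  (fun N => value_mult d N /\ e (lead_coef N) != 0); first by exists p.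
have small R : value_mult d R -> (size R < size N)%N -> map_poly e R = 0.
  apply: map_poly_eq0_lt_size => {}R JR ltRN; apply/eqP/negPn/negP => lR.
  by have := minN R (conj JR lR); rewrite leqNgt ltRN.
have nzN : N != 0 by apply: contraNneq lN => ->; rewrite lead_coef0 rmorph0.
have nzp : p != 0 by apply: contraNneq lp => ->; rewrite lead_coef0 rmorph0.
have modN0 q : value_mult d q -> map_poly e (q %% N) = 0.
  by move=> Jq; apply: small; [apply: value_mult_modp | rewrite ltn_modpN0].
have divN q : value_mult d q ->
    e (lead_coef N) ^+ scalp q N * eval_at e a q
      = eval_at e a (q %/ N) * eval_at e a N.
  move=> Jq; have := congr1 (eval_at e a) (Pdiv.Idomain.divp_eq q N).
  by rewrite eval_atZ rmorphXn rmorphD rmorphM [X in _ + X]eval_atE modN0 //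
     horner0 addr0.
case: (leqP (size N) 1) => [szN|szN].
  exists (lead_coef N) => //; move: JN; rewrite {1}(size1_polyC szN).
  by rewrite lead_coefE; case: (size N) szN => [|[]].
(* Suppose [N] is not constant. It does not vanish at [a], since a nonzero multiple of [d] is a
   multiple of its value. So [p(a) = 0] makes [p %/ N] vanish at [a]; being shorter than [p], it is
   killed by [e], and then so is [p], against [lp]. *)
have nzNa : eval_at e a N != 0.
  apply: contraNneq nzd => N0.
  have /divN/eqP : value_mult d delta by exists 1; rewrite rmorph1 mul1r.
  by rewrite N0 mulr0 mulf_eq0 expf_eq0 (negPf lN) andbF.
have /eqP := divN _ Jp; rewrite p0 mulr0 eq_sym mulf_eq0 (negPf nzNa) orbF.
move=> /eqP Q0; have eQ0 : map_poly e (p %/ N) = 0.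
  apply: minp => //; rewrite size_divp //.
  by rewrite ltn_subrL size_poly_gt0 nzp -subn1 subn_gt0 szN.
have := congr1 (map_poly e) (Pdiv.Idomain.divp_eq p N).
rewrite map_polyZ rmorphD rmorphM /= eQ0 mul0r modN0 // addr0 rmorphXn.
move/eqP; rewrite -mul_polyC mulf_eq0 polyC_eq0 expf_eq0 (negPf lN) andbF /= => /eqP ep0.
by move: lp; rewrite lead_coefE -coef_map ep0 coef0 eqxx.
Qed.

Variables (K : fieldType).
Hypothesis closedK : forall p : {poly K}, size p != 1%N -> exists c, root p c.

(** A root of [q - 1] is a point where [q] takes the value 1. *)
Lemma nonroot_exists (q : {poly K}) : q != 0 -> exists c, q.[c] != 0.
Proof.
move=> nzq; have [szq|szq] := leqP (size q) 1.
  by exists 0; rewrite (size1_polyC szq) hornerC; move: nzq;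
    rewrite {1}(size1_polyC szq) polyC_eq0.
have [|c] := closedK (p := q - 1).
  by rewrite size_polyDl ?size_polyN ?size_poly1 // neq_ltn szq orbT.
rewrite /root !hornerE subr_eq0 => /eqP qc1; exists c.
by rewrite qc1 oner_eq0.
Qed.

(** If [a] is transcendental over [e T], it may be sent to any non-root of the image of [delta]. If
    it is algebraic, it is sent to a root of the image of a minimal polynomial [p], with [phi]
    nonzero on [lead_coef p], to keep the degree, and on a constant [r] that is a multiple of
    [delta] at [a]. *)
Lemma specializable_eval_at : specializable K e -> specializable K (eval_at e a).
Proof.
move=> spec delta nzd.
have [[p0 Ep0 lp0] | transc] :=
    classic (exists2 p, eval_at e a p = 0 & e (lead_coef p) != 0); last first.
  have inj P : eval_at e a P = 0 -> map_poly e P = 0.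
    move=> P0; apply: (@map_poly_eq0_lt_size 0 (size P).+1) => //; last first.
      by exists 0; rewrite mulr0.
    move=> N [s]; rewrite mulr0 => N0 _; apply/eqP/negPn/negP=> lN.
    by apply: transc; exists N.
  have nzed : map_poly e delta != 0.
    by apply: contraNneq nzd; rewrite eval_atE => ->; rewrite horner0.
  (* The index comes from the image of [delta], since [e] may kill the leading coefficient of
     [delta] itself. *)
  have [|phi ker_phi nz_phi] := spec delta`_(size (map_poly e delta)).-1.
    by rewrite -coef_map -lead_coefE lead_coef_eq0.
  have [|c nzc] := @nonroot_exists (map_poly phi delta).
    by apply: contraNneq nz_phi => phid0; rewrite -coef_map phid0 coef0.
  exists (eval_at phi c) => // P /inj eP0.
  rewrite eval_atE (_ : map_poly phi P = 0) ?horner0 //.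
  apply/polyP=> i; rewrite coef_map coef0; apply: ker_phi.
  by rewrite -coef_map eP0 coef0.
have [|p [Ep lp] minp] := @ex_minimal_size _
  (fun p => eval_at e a p = 0 /\ e (lead_coef p) != 0); first by exists p0.
have small q : eval_at e a q = 0 -> (size q < size p)%N -> map_poly e q = 0.
  move=> q0; apply: (@map_poly_eq0_lt_size 0) => //; last first.
    by exists 0; rewrite mulr0.
  move=> N [s]; rewrite mulr0 => N0 ltN; apply/eqP/negPn/negP=> lN.
  by have := minp N (conj N0 lN); rewrite leqNgt ltN.
have [r er [s Es]] := eval_dvd_const Ep lp small nzd.
have [|phi ker_phi nz_phi] := spec (r * lead_coef p).
  by rewrite rmorphM mulf_neq0.
move: nz_phi; rewrite rmorphM mulf_eq0 negb_or => /andP[phir philp].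
have szp : size (map_poly phi p) = size p by rewrite size_map_poly_id0.
have [|c rc] := closedK (p := map_poly phi p).
  rewrite szp; apply: contraNneq lp => szp1.
  have pC := size1_polyC (eq_leq szp1); rewrite lead_coefE szp1 /=.
  by rewrite -Ep {2}pC eval_atC.
have nzp : p != 0 by apply: contraNneq lp => ->; rewrite lead_coef0 rmorph0.
(* The remainder of [P] modulo [p] also vanishes at [a] and is shorter than [p], hence is killed by
   [e] and so by [phi]; the other term vanishes because [c] is a root of the image of [p]. *)
have ker' P : eval_at e a P = 0 -> eval_at phi c P = 0.
  move=> P0; have Ediv := Pdiv.Idomain.divp_eq P p.
  have emod : map_poly e (P %% p) = 0.
    apply: small; last by rewrite ltn_modpN0.
    have := congr1 (eval_at e a) Ediv.
    by rewrite eval_atZ rmorphD rmorphM P0 Ep !mulr0 add0r => /esym.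
  have phimod : map_poly phi (P %% p) = 0.
    apply/polyP=> i; rewrite coef_map coef0; apply: ker_phi.
    by rewrite -coef_map emod coef0.
  have := congr1 (eval_at phi c) Ediv.
  rewrite eval_atZ rmorphD rmorphM /= [X in _ * X + _]eval_atE (rootP rc).
  rewrite mulr0 add0r [RHS]eval_atE phimod horner0 rmorphXn.
  by move/eqP; rewrite mulf_eq0 expf_eq0 (negPf philp) andbF /= => /eqP.
(* [r - s * delta] vanishes at [a], so it is sent to 0; if [delta] were too, so would be [r]. *)
exists (eval_at phi c) => //; apply: contraNneq phir => delta0.
have := ker' (r%:P - s * delta).
rewrite !rmorphB !rmorphM /= -Es subrr delta0 mulr0 subr0 eval_atC => -> //.
Qed.

End Adjunction.

Lemma pchar0_intr_eq0 (R : idomainType) (n : int) :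
  [pchar R] =i pred0 -> (n%:~R == 0 :> R) = (n == 0).
Proof.
move=> char0; have nat0 := (pcharf0P R).1 char0.
by case: n => n; rewrite ?NegzE ?rmorphN ?oppr_eq0 /= ?pmulrn -?pmulrn nat0.
Qed.

Lemma specializable_int (D : idomainType) (K : fieldType) :
    [pchar D] =i pred0 -> [pchar K] =i pred0 ->
  specializable K (intmul 1 : {rmorphism int -> D}).
Proof.
move=> charD charK d; rewrite /= pchar0_intr_eq0 // => nzd.
exists (intmul 1 : {rmorphism int -> K}) => [t /eqP|] /=.
  by rewrite pchar0_intr_eq0 // => /eqP ->.
by rewrite pchar0_intr_eq0.
Qed.

(** Adjoining the entries of [s] one at a time makes [T] an iterated polynomial ring over [int],
    hence a domain as pseudo-division requires. *)
Lemma specializable_cover (D : idomainType) (K : fieldType) (s : seq D) :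
    [pchar D] =i pred0 -> [pchar K] =i pred0 ->
    (forall p : {poly K}, size p != 1%N -> exists c, root p c) ->
  exists (T : idomainType) (e : {rmorphism T -> D}),
    specializable K e /\ forall x, x \in s -> exists t, e t = x.
Proof.
move=> charD charK closedK; elim: s => [|a s [T [e [spec cover]]]].
  exists int, (intmul 1 : {rmorphism int -> D}).
  by split=> //; apply: specializable_int.
exists {poly T}, (eval_at e a).
split; first exact: specializable_eval_at.
move=> x; rewrite inE => /predU1P[->|/cover[t <-]].
  by exists 'X; rewrite eval_atX.
by exists t%:P; rewrite eval_atC.
Qed.

Lemma lift_poly (T D : nzRingType) (e : {rmorphism T -> D}) (P : {poly D}) :
  (forall i, exists t, e t = P`_i) -> exists Q, map_poly e Q = P.
Proof.
elim/poly_ind: P => [|P c IHP] im; first by exists 0; rewrite map_poly0.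
have [|Q EQ] := IHP.
  by move=> i; have [t Et] := im i.+1; exists t; rewrite Et coefD coefMX coefC addr0.
have [t Et] := im 0%N; exists (Q * 'X + t%:P).
rewrite rmorphD rmorphM /= map_polyX map_polyC EQ /= Et.
by rewrite coefD coefMX coefC add0r.
Qed.

Lemma lift_bipoly (T D : nzRingType) (e : {rmorphism T -> D})
    (P : {poly {poly D}}) :
  (forall i j, exists t, e t = P`_i`_j) ->
  exists Q, map_poly (map_poly e) Q = P.
Proof. by move=> im; apply: lift_poly => i; apply: lift_poly => j. Qed.

(** * The complex numbers *)

Section ComplexClosed.
Import mathcomp.real_closed.complex.
Local Notation Ri := (mathcomp.real_closed.complex.complex Rdefinitions.R).

(** Through this embedding into the complex field of [real_closed], algebraic closedness and
    characteristic zero are inherited. *)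
Definition to_Ri (z : Defs.complex) : Ri := Complex (Re_c z) (Im_c z).

Fact to_Ri_zmod : zmod_morphism to_Ri.
Proof. by move=> [a b] [c d]. Qed.
Fact to_Ri_monoid : monoid_morphism to_Ri.
Proof. by split=> // [[a b] [c d]]. Qed.
HB.instance Definition _ :=
  GRing.isZmodMorphism.Build Defs.complex Ri to_Ri to_Ri_zmod.
HB.instance Definition _ :=
  GRing.isMonoidMorphism.Build Defs.complex Ri to_Ri to_Ri_monoid.

Lemma complex_closed (p : {poly Defs.complex}) :
  size p != 1%N -> exists c, root p c.
Proof.
move=> szp; have : size (map_poly to_Ri p) != 1%N by rewrite size_map_poly.
move=> /closed_rootP[[a b] rab]; exists (Cplx a b).
by rewrite -(fmorph_root to_Ri).
Qed.

Lemma complex_pchar0 : [pchar Defs.complex] =i pred0.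
Proof. by move=> p; rewrite -(fmorph_pchar to_Ri) Num.Theory.pchar_num. Qed.

End ComplexClosed.

(** * Jacobian pairs under the Jacobian conjecture *)

Section Substitution.
Variable (R : comNzRingType).
Implicit Types (A B : {poly {poly R}}).

HB.instance Definition _ := GRing.RMorphism.copy (@bC R) (polyC \o polyC).

Definition subst_xy A B : {rmorphism {poly {poly R}} -> {poly {poly R}}} :=
  eval_at (eval_at (@bC R) B) A.

Lemma subst_xyC A B c : subst_xy A B (bC c) = bC c.
Proof. by rewrite /subst_xy /= eval_atC eval_atC. Qed.

Lemma subst_xyX A B : subst_xy A B bx = A.
Proof. by rewrite /subst_xy /= eval_atX. Qed.

Lemma subst_xyY A B : subst_xy A B by_ = B.
Proof. by rewrite /subst_xy /= eval_atC eval_atX. Qed.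

Lemma dyD A B : dy (A + B) = dy A + dy B.
Proof. exact: raddfD. Qed.

Lemma dyM A B : dy (A * B) = dy A * B + A * dy B.
Proof.
apply/polyP=> i; rewrite coefD /dy coef_map !coefM /= raddf_sum /= -big_split.
by apply: eq_bigr => j _; rewrite /= derivM !coef_map.
Qed.

Section ChainRule.
Variable (d : {poly {poly R}} -> {poly {poly R}}).
Hypotheses (dD : forall P Q, d (P + Q) = d P + d Q)
           (dM : forall P Q, d (P * Q) = d P * Q + P * d Q)
           (dC : forall c, d (bC c) = 0).

(** The chain rule for an abstract derivation trivial on constants, so that it applies to [dx] and
    [dy] alike. The induction runs first on polynomials in [y], then on those in [x]. *)
Lemma derivation_subst_xy A B P :
  d (subst_xy A B P)
    = subst_xy A B (dx P) * d A + subst_xy A B (dy P) * d B.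
Proof.
set f := subst_xy A B.
have d0 : d 0 = 0 by rewrite -[0](rmorph0 (@bC R)) dC.
have dfC q : d (f q%:P) = f (q^`())%:P * d B.
  elim/poly_ind: q => [|q c IHq].
    by rewrite deriv0 !rmorph0 mul0r d0.
  have fX : f ('X)%:P = B by rewrite -[RHS](subst_xyY A B).
  have fC : f (c%:P)%:P = bC c by rewrite -[RHS](subst_xyC A B).
  rewrite derivD derivM derivC derivX mulr1 addr0 !rmorphD !rmorphM /= fX fC.
  by rewrite dD dM dC addr0 IHq -/f mulrDl mulrAC.
elim/poly_ind: P => [|P q IHP].
  by rewrite /dx /dy deriv0 map_poly0 !rmorph0 !mul0r d0 addr0.
have fX : f 'X = A by rewrite -[RHS](subst_xyX A B).
rewrite /dx derivD derivM derivC derivX mulr1 addr0 dyD dyM.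
have -> : dy ('X : {poly {poly R}}) = 0.
  apply/polyP=> i; rewrite /dy coef_map coefX coef0 /=.
  by case: (i == 1%N); rewrite ?derivC ?deriv0 // -(polyC1 R) derivC.
have -> : dy q%:P = (q^`())%:P by rewrite /dy map_polyC.
rewrite mulr0 addr0 !rmorphD !rmorphM /= fX dD dM IHP dfC -/(dx P).
by rewrite !mulrDl; rewrite -!addrA [_ * _ * A]mulrAC; congr (_ + _);
  rewrite [in RHS]addrCA [_ * _ * A]mulrAC; congr (_ + _).
Qed.

End ChainRule.

(** By the chain rule the other contribution is a multiple of [Jac A A = 0]. *)
Lemma Jac_subst_xy A B P :
  Jac A (subst_xy A B P) = subst_xy A B (dy P) * Jac A B.
Proof.
have dxC (c : R) : dx (bC c) = 0 by rewrite /dx derivC.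
have dyC (c : R) : dy (bC c) = 0 by rewrite /dy map_polyC /= derivC.
rewrite /Jac (@derivation_subst_xy (@dx R) (@derivD _) (@derivM _) dxC).
rewrite (derivation_subst_xy dyD dyM dyC).
set f := subst_xy A B; set a := dx A; set b := dy A; set c := f (dy P).
rewrite mulrBr !mulrDr opprD addrACA.
rewrite [a * (_ * b)]mulrCA [b * (_ * a)]mulrCA [b * a]mulrC subrr add0r.
by rewrite ![_ * (c * _)]mulrCA.
Qed.

End Substitution.

Lemma Jac_eq0_subalg (JC : JacobianConjecture2_C)
    (A B w : {poly {poly Defs.complex}}) :
  in_units_const (Jac A B) -> Jac A w = 0 -> in_subalg_gen A w.
Proof.
move=> JAB JAw; set f := subst_xy A B.
have [|| g fK gK] := JC f.
- exact: subst_xyC.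
- by rewrite subst_xyX subst_xyY.
have dyg0 : dy (g w) = 0.
  have [c uc JE] := JAB; have nzc : c != 0 by rewrite -unitfE.
  move: JAw; rewrite -{1}[w]gK Jac_subst_xy JE => /eqP.
  rewrite mulf_eq0 !polyC_eq0 (negPf nzc) orbF.
  by move=> /eqP fd0; apply: (can_inj fK); rewrite rmorph0.
(* In characteristic zero, [P_y = 0] leaves only the coefficients of degree 0 in [y]. *)
have gwE : g w = map_poly polyC (\poly_(i < size (g w)) (g w)`_i`_0).
  apply/polyP=> i; rewrite coef_map coef_poly /=.
  case: ltnP => [_|le_i]; last by rewrite nth_default // polyC0.
  apply/polyP=> -[|j]; rewrite coefC //=.
  have := congr1 (fun P : {poly {poly Defs.complex}} => P`_i`_j) dyg0.
  rewrite /dy coef_map coef_deriv !coef0 -mulr_natr => /eqP.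
  rewrite mulf_eq0 => /orP[/eqP //|].
  by have /pcharf0P -> := complex_pchar0.
exists (\poly_(i < size (g w)) (g w)`_i`_0).
rewrite -{1}[w]gK {1}gwE /f /subst_xy /= eval_atE; congr (_.[_]).
by apply/polyP=> i; rewrite !coef_map /= eval_atC.
Qed.

(** * Restriction to a line and inversion of truncated power series *)

Definition on_line (R : comNzRingType) (al be : R) :
  {rmorphism {poly {poly R}} -> {poly R}} :=
  eval_at (eval_at (@polyC R) (be *: 'X)) (al *: 'X).

Lemma on_line_bC (R : comNzRingType) (al be c : R) :
  on_line al be (bC c) = c%:P.
Proof. by rewrite /on_line /= !eval_atC. Qed.

Lemma eval_at_map (R S R' S' : comNzRingType) (f : {rmorphism R -> S})
    (f' : {rmorphism R' -> S'}) (g : {rmorphism R -> R'})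
    (h : {rmorphism S -> S'}) a P :
  (forall x, h (f x) = f' (g x)) ->
  h (eval_at f a P) = eval_at f' (h a) (map_poly g P).
Proof.
move=> hf; rewrite !eval_atE -horner_map; congr _.[_].
by apply/polyP=> i; rewrite !coef_map /= hf.
Qed.

Lemma map_on_line (R S : comNzRingType) (f : {rmorphism R -> S}) al be P :
  map_poly f (on_line al be P)
    = on_line (f al) (f be) (map_poly (map_poly f) P).
Proof.
have mapZX c : map_poly f (c *: 'X) = f c *: 'X by rewrite map_polyZ map_polyX.
rewrite /on_line -!mapZX; apply: eval_at_map => q; apply: eval_at_map => x.
exact: map_polyC.
Qed.

Lemma on_line_subalg (R : comNzRingType) (al be : R) (g : {poly R}) A :
  on_line al be (map_poly bC g).[A] = g \Po on_line al be A.
Proof.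
rewrite -horner_map /comp_poly; congr _.[_].
by apply/polyP=> i; rewrite !coef_map /= on_line_bC.
Qed.

Lemma map_subalg (R S : comNzRingType) (f : {rmorphism R -> S})
    (g : {poly R}) A :
  map_poly (map_poly f) (map_poly bC g).[A]
    = (map_poly bC (map_poly f g)).[map_poly (map_poly f) A].
Proof.
rewrite -horner_map; congr _.[_].
by apply/polyP=> i; rewrite !coef_map /= /bC map_polyC /= map_polyC.
Qed.

Lemma map_Jac (R S : comNzRingType) (f : {rmorphism R -> S}) A B :
  map_poly (map_poly f) (Jac A B)
    = Jac (map_poly (map_poly f) A) (map_poly (map_poly f) B).
Proof.
have map_dx P : map_poly (map_poly f) (dx P) = dx (map_poly (map_poly f) P).
  by rewrite /dx deriv_map.
have map_dy P : map_poly (map_poly f) (dy P) = dy (map_poly (map_poly f) P).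
  by apply/polyP=> i; rewrite /dy !coef_map /= deriv_map.
by rewrite /Jac rmorphB !rmorphM /= !map_dx !map_dy.
Qed.

(** This is the derivative of [P] at the origin in the direction [(al, be)]. *)
Lemma on_line_coef1 (R : comNzRingType) (al be : R) (P : {poly {poly R}}) :
  (on_line al be P)`_1 = al * P`_1`_0 + be * P`_0`_1.
Proof.
have inner q : eval_at (@polyC R) (be *: 'X) q = q \Po (be *: 'X) by [].
have inner0 q : (q \Po (be *: 'X))`_0 = q`_0.
  by rewrite -!horner_coef0 horner_comp !hornerE ?mulr0.
have inner1 q : (q \Po (be *: 'X))`_1 = be * q`_1.
  elim/poly_ind: q => [|q c _]; first by rewrite comp_poly0 !coef0 mulr0.
  rewrite comp_polyD comp_polyM comp_polyX comp_polyC -scalerAr.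
  by rewrite !coefD coefZ !coefMX !coefC /= !addr0 inner0.
elim/poly_ind: P => [|P q _].
  by rewrite rmorph0 !coef0 !mulr0 addr0.
rewrite rmorphD rmorphM /= /on_line eval_atX eval_atC -/(on_line al be) inner.
rewrite -scalerAr coefD coefZ coefMX inner1 /= !coefD !coefMX !coefC /= addr0.
rewrite add0r; congr (_ * _ + _) => {q inner1}.
elim/poly_ind: P => [|P q _]; first by rewrite rmorph0 !coef0.
rewrite rmorphD rmorphM /= eval_atX eval_atC inner -scalerAr.
by rewrite !coefD coefZ !coefMX coefC /= inner0 mulr0 !add0r coefC.
Qed.

Lemma poly_coef1_decomp (R : nzRingType) (a : {poly R}) : a`_1 = 1 ->
  exists2 r : {poly R}, a - (a`_0)%:P = r * 'X & r`_0 = 1.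
Proof.
elim/poly_ind: a => [|r c _]; first by rewrite coef0 => /esym/eqP; rewrite oner_eq0.
rewrite coefD coefMX coefC /= addr0 => r0; exists r => //.
by rewrite !coefE /= add0r addrK.
Qed.

(** Since [a - a_0] is ['X] times a series with constant term 1, its [m]-th power starts with
    ['X^m]; a multiple of it corrects the coefficient of order [m] without any division in [R]. *)
Lemma comp_poly_approx (R : comNzRingType) (a v : {poly R}) (m : nat) :
  a`_1 = 1 ->
  exists2 g : {poly R}, (size g <= m)%N &
    forall i, (i < m)%N -> (v - (g \Po a))`_i = 0.
Proof.
move=> a1; have [r Er r0] := poly_coef1_decomp a1.
elim: m => [|m [g szg Eg]]; first by exists 0; rewrite ?size_poly0.
set c := (v - (g \Po a))`_m.
exists (g + c *: ('X - (a`_0)%:P) ^+ m) => [|i].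
  rewrite (leq_trans (size_polyD _ _)) // geq_max (leq_trans szg) //=.
  by rewrite (leq_trans (size_scale_leq _ _)) // size_exp_XsubC.
rewrite comp_polyD -[c *: _]mul_polyC comp_polyM comp_polyC mul_polyC.
rewrite rmorphXn /= comp_polyB comp_polyX comp_polyC Er.
rewrite opprD addrA coefB coefZ exprMn_comm; last exact: commr_polyX.
rewrite coefMXn ltnS leq_eqVlt => /predU1P[->|lt_im].
  by rewrite ltnn subnn -horner_coef0 hornerE horner_coef0 r0 expr1n mulr1 subrr.
by rewrite lt_im mulr0 subr0 Eg.
Qed.

(** Write [k = q * ('X - a_0)^j] with [q(a_0)] nonzero. Then [k \Po a] has coefficient [q(a_0)] at
    order [j], and [j < size k <= m]. *)
Lemma comp_poly_eq0_trunc (R : idomainType) (a k : {poly R}) (m : nat) :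
    a`_1 = 1 -> (size k <= m)%N ->
  (forall i, (i < m)%N -> (k \Po a)`_i = 0) -> k = 0.
Proof.
move=> a1 szk k0; have [r Er r0] := poly_coef1_decomp a1.
apply/eqP/negPn/negP=> nzk.
have [j [q]] := multiplicity_XsubC k a`_0; rewrite nzk /= => nrq Ek.
have nzq : q != 0 by apply: contraNneq nrq => ->; rewrite root0.
have lt_jm : (j < m)%N.
  apply: leq_trans szk; rewrite Ek size_Mmonic ?monic_exp ?monicXsubC //.
  rewrite size_exp_XsubC addnS /= -[X in (X < _)%N]add0n ltn_add2r.
  by rewrite size_poly_gt0.
case/rootP: nrq; rewrite -[RHS](k0 j lt_jm) [in RHS]Ek.
rewrite comp_polyM rmorphXn /= comp_polyB comp_polyX comp_polyC Er exprMn.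
rewrite mulrA coefMXn ltnn subnn -horner_coef0 !hornerE horner_comp.
by rewrite !horner_coef0 r0 expr1n mulr1.
Qed.

(** * Transport of identities along a specialization *)

Section Transport.
Variables (T D K : comNzRingType).
Variables (e : {rmorphism T -> D}) (phi : {rmorphism T -> K}).
Hypothesis ker_phi : forall t, e t = 0 -> phi t = 0.

Lemma transport_eq t t' : e t = e t' -> phi t = phi t'.
Proof.
move=> Et; apply/eqP; rewrite -subr_eq0 -rmorphB ker_phi //.
by rewrite rmorphB Et subrr.
Qed.

Lemma transport_map_eq0 P : map_poly e P = 0 -> map_poly phi P = 0.
Proof.
move=> P0; apply/polyP=> i; rewrite coef_map coef0; apply: ker_phi.
by rewrite -coef_map P0 coef0.
Qed.

End Transport.

Lemma transport_bipoly_eq (T D K : comNzRingType)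
    (e : {rmorphism T -> D}) (phi : {rmorphism T -> K}) :
  (forall t, e t = 0 -> phi t = 0) ->
  forall P Q : {poly {poly T}},
    map_poly (map_poly e) P = map_poly (map_poly e) Q ->
    map_poly (map_poly phi) P = map_poly (map_poly phi) Q.
Proof.
move=> ker_phi; apply: transport_eq.
by apply: transport_map_eq0; apply: transport_map_eq0.
Qed.

Definition bicoefs (R : nzRingType) (P : {poly {poly R}}) : seq R :=
  flatten [seq polyseq q | q <- polyseq P].

Lemma lift_bicoefs (T D : nzRingType) (e : {rmorphism T -> D})
    (P : {poly {poly D}}) :
  (forall x, x \in bicoefs P -> exists t, e t = x) ->
  exists Q, map_poly (map_poly e) Q = P.
Proof.
move=> im; apply: lift_bipoly => i j.
have [lt_i|le_i] := ltnP i (size P); last first.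
  by exists 0; rewrite rmorph0 [P`_i]nth_default // coef0.
have [lt_j|le_j] := ltnP j (size P`_i); last first.
  by exists 0; rewrite rmorph0 nth_default.
apply: im; apply/flattenP; exists (polyseq P`_i); last exact: mem_nth.
exact/map_f/mem_nth.
Qed.

(** * Reduction of a general domain to the complex numbers *)

Theorem theorem3p6 :
  JacobianConjecture2_C ->
  forall (D : idomainType), [pchar D] =i pred0 ->
  forall A B w : {poly {poly D}},
    in_units_const (Jac A B) ->
    Jac A w = 0 ->
    in_subalg_gen A w.
Proof.
move=> JC D charD A B w [c uc JAB] JAw.
(* With this direction, the linear coefficient of [A] on the line is [c^-1] times the constant term
   of [Jac A B], that is 1. *)
pose al := c^-1 * B`_0`_1; pose be := - (c^-1 * B`_1`_0).
have a1 : (on_line al be A)`_1 = 1.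
  have := congr1 (fun P : {poly {poly D}} => P`_0`_0) JAB.
  rewrite /Jac /dx /dy !coefB !coef0M !coef_deriv !coef_map /= !coef_deriv.
  rewrite /bC !coefC /= !mulr1n => Ec.
  rewrite on_line_coef1 -(mulVr uc) -[X in _ = _ * X]Ec mulrBr /al /be mulNr.
  by rewrite -!mulrA [B`_0`_1 * _]mulrC [B`_1`_0 * _]mulrC.
set m := (size (on_line al be w)).+1.
have [g szg Eg] := comp_poly_approx (on_line al be w) m a1.
exists g; apply/eqP; rewrite -subr_eq0; apply/negPn/negP => nz_diff.
(* Including [c^-1] keeps the specialized Jacobian a unit; [al] and [be] let the line itself
   specialize. *)
pose s := [:: al, be, c, c^-1
             & bicoefs A ++ bicoefs B ++ bicoefs w ++ polyseq g].
have [T [e [spec cover]]] :=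
  specializable_cover s charD complex_pchar0 complex_closed.
have [|al0 Eal] := cover al; first by rewrite !inE eqxx.
have [|be0 Ebe] := cover be; first by rewrite !inE eqxx orbT.
have [|u0 Eu] := cover c; first by rewrite !inE eqxx !orbT.
have [|v0 Ev] := cover c^-1; first by rewrite !inE eqxx !orbT.
have [|A0 EA] := @lift_bicoefs _ _ e A.
  by move=> x xA; apply: cover; rewrite !inE !mem_cat xA !orbT.
have [|B0 EB] := @lift_bicoefs _ _ e B.
  by move=> x xB; apply: cover; rewrite !inE !mem_cat xB !orbT.
have [|w0 Ew] := @lift_bicoefs _ _ e w.
  by move=> x xw; apply: cover; rewrite !inE !mem_cat xw !orbT.
have [|g0 Egg] := @lift_poly _ _ e g.
  move=> i; have [lt_i|le_i] := ltnP i (size g); last first.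
    by exists 0; rewrite rmorph0 nth_default.
  by apply: cover; rewrite !inE !mem_cat (mem_nth 0 lt_i) !orbT.
pose diff0 := w0 - (map_poly bC g0).[A0].
have Ediff : map_poly (map_poly e) diff0 = w - (map_poly bC g).[A].
  by rewrite rmorphB /= map_subalg Ew EA Egg.
have [i [j nz_ij]] : exists i j, e diff0`_i`_j != 0.
  exists (size (w - (map_poly bC g).[A])).-1.
  exists (size (lead_coef (w - (map_poly bC g).[A]))).-1.
  have -> k l : e diff0`_k`_l = (w - (map_poly bC g).[A])`_k`_l.
    by rewrite -Ediff coef_map /= coef_map.
  by rewrite -!lead_coefE !lead_coef_eq0.
have [phi ker_phi nz_phi] := spec _ nz_ij.
pose line0 := on_line al0 be0.
have Eline P : map_poly e (line0 P) = on_line al be (map_poly (map_poly e) P).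
  by rewrite map_on_line Eal Ebe.
have tr := transport_bipoly_eq ker_phi.
pose A1 := map_poly (map_poly phi) A0; pose w1 := map_poly (map_poly phi) w0.
pose g1 := map_poly phi g0.
pose line1 := on_line (phi al0) (phi be0).
have [||h Eh] := @Jac_eq0_subalg JC A1 (map_poly (map_poly phi) B0) w1.
- exists (phi u0).
    apply/unitrP; exists (phi v0); rewrite -!rmorphM -(rmorph1 phi).
    by split; apply: (transport_eq ker_phi);
      rewrite rmorphM rmorph1 Eu Ev ?mulVr ?mulrV.
  have map_bC (S : comNzRingType) (f : {rmorphism T -> S}) t :
      bC (f t) = map_poly (map_poly f) (bC t).
    by rewrite /bC map_polyC /= map_polyC.
  rewrite -map_Jac map_bC; apply: tr.
  by rewrite map_Jac EA EB JAB -map_bC Eu.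
- rewrite -map_Jac -[RHS](rmorph0 (map_poly (map_poly phi))).
  by apply: tr; rewrite map_Jac EA Ew JAw rmorph0.
have a1' : (line1 A1)`_1 = 1.
  rewrite -map_on_line coef_map -(rmorph1 phi).
  by apply: (transport_eq ker_phi); rewrite -coef_map Eline EA a1 rmorph1.
have Eline_w : line1 w1 = h \Po line1 A1 by rewrite Eh on_line_subalg.
(* [line1 A1] has positive degree, so composing with it does not lower the degree of [h]. As
   [size_comp_poly] relates only predecessors of sizes, the bound uses the successor in [m]. *)
have szh : (size h <= m)%N.
  have sz_line_w : (size (line1 w1) <= size (on_line al be w))%N.
    apply/leq_sizeP=> k le_k; rewrite -map_on_line coef_map; apply: ker_phi.
    by rewrite -coef_map Eline Ew nth_default.
  have sz_line_A : (1 < size (line1 A1))%N.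
    rewrite ltnNge; apply/negP=> /leq_sizeP/(_ 1%N isT) /eqP.
    by rewrite a1' oner_eq0.
  rewrite (leq_trans (leqSpred _)) // ltnS (leq_trans _ sz_line_w) //.
  rewrite (leq_trans _ (leq_pred _)) // Eline_w size_comp_poly.
  by rewrite leq_pmulr // -subn1 subn_gt0.
have szg1 : (size g1 <= m)%N.
  apply/leq_sizeP=> k le_mk; rewrite coef_map; apply: ker_phi.
  by rewrite -coef_map Egg nth_default // (leq_trans szg).
(* Composed with [line1 A1], both [h] and [g1] agree with [line1 w1] below order [m]. *)
have hg1 : h = g1.
  apply/eqP; rewrite -subr_eq0; apply/eqP.
  apply: (@comp_poly_eq0_trunc _ (line1 A1) _ m) => // [|k lt_km].
    by rewrite (leq_trans (size_polyD _ _)) // geq_max size_polyN szh.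
  rewrite comp_polyB -Eline_w -!map_on_line -map_comp_poly -rmorphB coef_map.
  apply: ker_phi; rewrite -coef_map rmorphB /= map_comp_poly !Eline Egg Ew EA.
  exact: Eg.
case/eqP: nz_phi.
have -> : phi diff0`_i`_j = (map_poly (map_poly phi) diff0)`_i`_j.
  by rewrite coef_map /= coef_map.
by rewrite rmorphB /= map_subalg -/A1 -/w1 -/g1 -hg1 -Eh subrr !coef0.
Qed.
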